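(* Let $(X,d)$ be a finite metric space and let $h$ be a chaining functional of log-concave type with $|h'(1)|=1$ (left derivative). Then $$\gamma^*_h(X)\;\le\;\delta^{\mathbf{Ent}}_h(X)\;\le\;2\gamma^*_h(X)+\mathbf D(X)/e .$$
   Context: $B(x,r)=\{y\in X: d(x,y)\le r\}$ and $\mathbf D(X)=\max_{u,v\in X}d(u,v)$; $e$ is the base of the natural logarithm. Chaining functional: let $f:[0,\infty)\to[0,\infty)$ be a continuous, non-increasing probability density on $[0,\infty)$ and let $F(s)=\int_s^\infty f(t)\,dt$. The chaining functional induced by $f$ is $h(p)=F^{-1}(p)$ for $p\in(0,1]$ (so $h(1)=0$ and $h$ is strictly decreasing and convex). It is of log-concave type if $f$ is log-concave. The normalization $|h'(1)|=1$ is equivalent to $f(0)=1$. We read $h(0)=\lim_{p\to0^+}h(p)\in(0,\infty]$ and $0\cdot\infty=0$. With $\mu,\nu$ ranging over all probability measures on $X$, the dual program and the entropic dual are $$\gamma^*_h(X)=\max_{\nu}\min_{\mu}\int_X\int_0^\infty h(\mu(B(x,r)))\,dr\,d\nu(x),\qquad \delta^{\mathbf{Ent}}_h(X)=\max_\nu\int_X\int_0^\infty h(\nu(B(x,r)))\,dr\,d\nu(x),$$ where max and min are understood as supremum and infimum. *)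

(* Defs.v *)
From HB Require Import structures.
From mathcomp Require Import all_boot all_order all_algebra.
From mathcomp Require Import all_classical all_reals all_analysis.

Set Implicit Arguments.
Unset Strict Implicit.
Unset Printing Implicit Defensive.

Import Order.TTheory GRing.Theory Num.Theory.
Import numFieldNormedType.Exports.

Local Open Scope classical_set_scope.
Local Open Scope ring_scope.

(* The library builds generated sigma-algebras over pointed types only; the
   point merely says that the space is nonempty. *)
#[short(type="pointedMetricType")]
HB.structure Definition PointedMetric (R : numDomainType) :=
  {M of Pointed M & Metric R M}.

Section chaining_functional.
Context {R : realType}.
Implicit Types f h : R -> R.

(* Only the values of [f] on [0, +oo[ and of [h] on ]0, 1] matter below. *)

Definition chaining_density f : Prop :=
  [/\ {within `[0, +oo[, continuous f},
      {in `[0, +oo[ &, {homo f : s t /~ s <= t}},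
      (forall t, 0 <= t -> 0 <= f t) &
      (\int[lebesgue_measure]_(t in `[0%R, +oo[) (f t)%:E = 1)%E].

Definition log_concave f : Prop :=
  forall s t a, 0 <= s -> 0 <= t -> 0 <= a <= 1 ->
    f s `^ a * f t `^ (1 - a) <= f (a * s + (1 - a) * t).

Definition tail f (s : R) : \bar R :=
  \int[lebesgue_measure]_(t in `[s, +oo[) (f t)%:E.

(* For p > 0 the equation [tail f s = p] has exactly one solution s >= 0, so
   this is h = F^-1 on ]0, 1]. *)
Definition induced_by f h : Prop :=
  forall p, 0 < p <= 1 -> 0 <= h p /\ tail f (h p) = p%:E.

Definition log_concave_chaining_functional h : Prop :=
  exists f, [/\ chaining_density f, log_concave f & induced_by f h].

Definition is_left_derivative h (a l : R) : Prop :=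
  (h t - h a) / (t - a) @[t --> a^'-] --> l.

(* [h] with its possibly infinite value at 0. *)
Definition extend0 h (p : R) : \bar R :=
  if p == 0 then lim ((h q)%:E @[q --> 0^'+]) else (h p)%:E.

End chaining_functional.

Section chaining_programs.
Context {R : realType} (X : pointedMetricType R).

Definition cball (x : X) (r : R) : set X := [set y | mdist x y <= r].

Definition diam : R := sup [set mdist p.1 p.2 | p in [set: X * X]].

Local Notation borel := (g_sigma_algebraType (@open X)).

Definition chaining_energy (h : R -> R) (mu nu : probability borel R) : \bar R :=
  \int[nu]_x \int[lebesgue_measure]_(r in `[0%R, +oo[)
    extend0 h (fine (mu (cball x r))).

Definition dual_program (h : R -> R) : \bar R :=
  ereal_sup [set ereal_inf [set chaining_energy h mu nu
                           | mu in [set: probability borel R]]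
            | nu in [set: probability borel R]].

Definition entropic_dual (h : R -> R) : \bar R :=
  ereal_sup [set chaining_energy h nu nu | nu in [set: probability borel R]].

End chaining_programs.

(* Main.v *)
Require Import Defs.
From mathcomp Require Import all_boot all_order all_algebra.
From mathcomp Require Import all_classical all_reals all_analysis.
From mathcomp Require Import finmap measurable_realfun ring lra.

Set Implicit Arguments.
Unset Strict Implicit.
Unset Printing Implicit Defensive.

Import Order.TTheory GRing.Theory Num.Theory.
Import numFieldNormedType.Exports.
Local Open Scope classical_set_scope.
Local Open Scope ring_scope.

(** The first inequality holds because [mu = nu] is one of the choices over
    which the dual program takes its infimum.

    For the second, the two energies of a fixed [nu] are compared: for every
    [mu], the energy of [(nu, nu)] is at most twice the energy of [(mu, nu)]
    plus [diam X / e] ([entropic_energy_le]).  The substitution [s = 2 r] in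
    the integral over radii produces the factor 2 and leaves, for each radius
    [r], a comparison of [h] at [b = nu (B (x, 2 r))] with [h] at
    [u = mu (B (x, r))].  Two facts settle it.

    - Analysis of [h].  If [F] is the tail of the density [f], log-concavity
      gives [f 0 * f (s + v) <= f s * f v], hence [f 0 * F s <= f s] after
      integration in [v].  The normalization of [h'(1)] forces [1 <= f 0], so
      [F <= f = - F'], that is, [F] decays at least like the exponential:
      [t - s <= ln (F s / F t)].  In terms of [h = F^-1] this reads
      [h b - h u <= ln (u / b)] for [b <= u], and [ln w <= w / e] turns it
      into [h b <= h u + (u / b) / e], which for [u < b] is immediate from
      monotonicity ([extend0_drop]).

    - Geometry of [X].  The [nu]-mean of the ratio [u / b] is at most 1
      ([mean_ball_ratio_le1]).  Writing [u] as the sum of the [mu]-masses of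
      the points [y] of [B (x, r)] and exchanging the two sums, this is the
      inclusion of [B (y, r)] in [B (x, 2 r)] for such [y].

    So for each [r] the [nu]-mean of [h b] exceeds that of [h u] by at most
    [1 / e], and for [r > diam X / 2] the ball [B (x, 2 r)] is the whole space
    and there is nothing to pay.  Integrating over [0, diam X / 2] and doubling
    gives [diam X / e].

    Since [X] is finite, all its subsets are Borel and integrals against
    probability measures are finite sums, so that no Fubini theorem enters. *)

(** * Affine changes of variable *)

Section affine.
Context {R : realType}.
Local Notation leb := (@lebesgue_measure R).

Definition affine (c b : R) (r : measurableTypeR R) : measurableTypeR R :=
  c * r + b.

Lemma measurable_affine (c b : R) : measurable_fun setT (affine c b).
Proof. by apply: measurable_funD => //; exact: measurable_funM. Qed.

(** Lebesgue measure is determined by its values on half-open intervals, where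
    the scaling by [c] is a computation.  The image measure is provided
    existentially because being a measure depends on the measurability of the
    affine map. *)
Lemma lebesgue_measure_affine (c b : R) (c0 : 0 < c) :
  exists2 m : {measure set (measurableTypeR R) -> \bar R},
    m = pushforward leb (affine c b) :> (set _ -> \bar R) &
    forall A, measurable A -> leb A = mscale (NngNum (ltW c0)) m A.
Proof.
unshelve eexists (pushforward leb (affine c b)).
- exact: measurable_affine.
- by [].
apply: lebesgue_measure_unique => // _ [[x y] _ <-].
change (leb `]x, y]%classic =
  (c%:E * leb (affine c b @^-1` `]x, y]%classic))%E).
have -> : affine c b @^-1` `]x, y]%classic =
    `](x - b) / c, (y - b) / c]%classic.
  apply/seteqP; split => t;
  by rewrite /= !in_itv/= /affine ltr_pdivrMr// ler_pdivlMr//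
    ltrBlDr lerBrDr (mulrC t).
rewrite !lebesgue_measure_itv /= !lte_fin ltr_pM2r ?invr_gt0// ltrD2r.
case: ifPn => xy; last by rewrite mule0.
rewrite -!EFinD -EFinM; congr EFin; field; exact/lt0r_neq0.
Qed.

(** The translation [c = 1] serves to integrate log-concavity, and the dilation
    [c = 2] to pass from balls of radius [2 r] to balls of radius [r]. *)
Lemma ge0_integral_ray_affine (G : R -> \bar R) (a c b : R) : 0 < c ->
  measurable_fun `[c * a + b, +oo[ G ->
  (forall r, c * a + b <= r -> (0 <= G r)%E) ->
  (\int[leb]_(s in `[(c * a + b)%R, +oo[) G s =
   c%:E * \int[leb]_(r in `[a, +oo[) G (c * r + b)%R)%E.
Proof.
move=> c0 mG G0.
have [m mE lebE] := lebesgue_measure_affine b c0.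
have G0' (y : R) : `[(c * a + b)%R, +oo[%classic y -> (0 <= G y)%E.
  by rewrite /= in_itv/= andbT => /G0.
rewrite (eq_measure_integral (mscale (NngNum (ltW c0)) m)); last first.
  by move=> A mA _; exact: lebE.
rewrite ge0_integral_mscale//= mE.
rewrite ge0_integral_pushforward//=; first last.
- by move=> y; rewrite in_setE => /G0'.
- exact: measurable_affine.
congr (_ * _)%E; congr (integral _ _ _).
by apply/seteqP; split => t; rewrite /= !in_itv/= !andbT lerD2r ler_pM2l.
Qed.

End affine.

(** * Tails of log-concave densities *)

Section log_concave_density.
Context {R : realType} (f : R -> R).
Implicit Types s t v d : R.
Hypothesis f_density : chaining_density f.
Local Notation leb := (@lebesgue_measure R).

Let f_ge0 t : 0 <= t -> 0 <= f t.
Proof. by case: f_density => _ _ + _ => /(_ t). Qed.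

Let f_noninc s t : 0 <= s -> s <= t -> f t <= f s.
Proof.
move=> s0 st; case: f_density => _ + _ _; apply => //;
  by rewrite in_itv/= andbT// (le_trans s0).
Qed.

Let f_meas (D : set R) : measurable D -> D `<=` `[0, +oo[%classic ->
  measurable_fun D (EFin \o f).
Proof.
move=> mD D0; apply/measurable_EFinP.
apply: (measurable_funS _ D0) => //.
by apply: subspace_continuous_measurable_fun => //; case: f_density.
Qed.

Lemma tail_ge0 s : 0 <= s -> (0 <= tail f s)%E.
Proof.
move=> s0; apply: integral_ge0 => t; rewrite /= in_itv/= andbT => st.
by rewrite lee_fin f_ge0// (le_trans s0).
Qed.

Lemma tail_split s t : 0 <= s -> s <= t ->
  (tail f s = \int[leb]_(x in `[s, t[) (f x)%:E + tail f t)%E.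
Proof.
move=> s0 st.
rewrite /tail (@itv_bndbnd_setU _ _ _ (BLeft t))//.
rewrite ge0_integral_setU//.
- apply: f_meas; first exact: measurableU.
  by move=> x /= [|]; rewrite !in_itv/= => /andP[]; rewrite ?andbT; lra.
- by move=> x /= [|]; rewrite !in_itv/= lee_fin => /andP[? _];
    apply: f_ge0; lra.
- apply/disj_setPLR => x /=; rewrite !in_itv/= => /andP[_].
  by rewrite andbT leNgt => ->.
Qed.

Lemma tail_itv_bounds s t : 0 <= s -> s <= t ->
  (((t - s) * f t)%:E <= \int[leb]_(x in `[s, t[) (f x)%:E
     <= ((t - s) * f s)%:E)%E.
Proof.
move=> s0 st.
have cstE (r : R) :
    ((t - s) * r)%:E = (\int[leb]_(x in `[s, t[) (cst r%:E x))%E.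
  rewrite integral_cst//= lebesgue_measure_itv/= lte_fin.
  case: ltP => [_|ts]; first by rewrite -EFinD -EFinM mulrC.
  by rewrite mule0 (_ : t - s = 0) ?mul0r//; lra.
have fm : measurable_fun `[s, t[ (EFin \o f).
  by apply: f_meas => // x; rewrite /= !in_itv/= => /andP[]; rewrite andbT; lra.
rewrite !cstE; apply/andP; split; apply: ge0_le_integral => //=.
- by move=> x _; rewrite lee_fin f_ge0// (le_trans s0).
- move=> x; rewrite in_itv/= => /andP[sx xt].
  by rewrite lee_fin f_noninc ?(ltW xt)// (le_trans s0).
- move=> x; rewrite in_itv/= => /andP[sx xt].
  by rewrite lee_fin f_ge0// (le_trans s0).
- by move=> x; rewrite in_itv/= => /andP[sx xt]; rewrite lee_fin f_noninc.
Qed.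

Lemma tail0 : tail f 0 = 1%:E.
Proof. by case: f_density. Qed.

Lemma tail_nonincreasing s t : 0 <= s -> s <= t -> (tail f t <= tail f s)%E.
Proof.
move=> s0 st; rewrite (tail_split s0 st) leeDr//.
apply: integral_ge0 => x; rewrite /= in_itv/= => /andP[sx _].
by rewrite lee_fin f_ge0// (le_trans s0).
Qed.

Lemma tail_fin_num s : 0 <= s -> tail f s \is a fin_num.
Proof.
move=> s0; rewrite ge0_fin_numE ?tail_ge0//.
by rewrite (le_lt_trans (tail_nonincreasing (lexx 0) s0))// tail0 ltry.
Qed.

(** All tails are finite, and this real-valued version makes linear arithmetic
    available. *)
Definition survival s : R := fine (tail f s).

Lemma survivalE s : 0 <= s -> tail f s = (survival s)%:E.
Proof. by move=> s0; rewrite fineK// tail_fin_num. Qed.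

Lemma survival_drop s t : 0 <= s -> s <= t ->
  (t - s) * f t <= survival s - survival t <= (t - s) * f s.
Proof.
move=> s0 st; have t0 := le_trans s0 st.
have := tail_itv_bounds s0 st; have := tail_split s0 st.
rewrite !survivalE//.
case: (\int[leb]_(x in `[s, t[) (f x)%:E)%E => // r.
rewrite !lee_fin => -[->]; lra.
Qed.

(** If no mass is lost on [0, s] with [s > 0], the rectangle bound gives
    [f s = 0], so that [f] vanishes from [s] on and the tail at [s] is 0. *)
Lemma survival_eq1 s : 0 <= s -> survival s = 1 -> s = 0.
Proof.
move=> s0 Fs; apply/eqP; rewrite eq_le s0 andbT leNgt; apply/negP => s_gt0.
have fs : f s = 0.
  have /andP[+ _] := survival_drop (lexx 0) s0.
  rewrite Fs {1}/survival tail0 /= subrr subr0 pmulr_rle0// => fs0.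
  by apply/eqP; rewrite eq_le fs0 f_ge0.
have : tail f s = 0%:E.
  rewrite /tail integral0_eq// => x; rewrite /= in_itv/= andbT => sx.
  have fx : f x <= 0 by rewrite -fs f_noninc.
  by congr EFin; apply/eqP; rewrite eq_le fx f_ge0// (le_trans s0).
by rewrite survivalE// Fs => -[] /eqP; rewrite oner_eq0.
Qed.

Hypothesis f_log_concave : log_concave f.

(** Both [s] and [v] are convex combinations of [s + v] and 0, with
    complementary weights; the two log-concavity inequalities are multiplied. *)
Lemma log_concave_submul s v : 0 <= s -> 0 <= v ->
  f 0 * f (s + v) <= f s * f v.
Proof.
move=> s0 v0.
have [sv_eq0|sv0] := eqVneq (s + v) 0.
  have [-> ->] : s = 0 /\ v = 0 by lra.
  by rewrite addr0.
have sv : 0 < s + v by rewrite lt_neqAle eq_sym sv0 addr_ge0.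
pose a := s / (s + v).
have a01 : 0 <= a <= 1.
  by rewrite /a divr_ge0 ?(ltW sv)//= ler_pdivrMr// mul1r; lra.
have b01 : 0 <= 1 - a <= 1 by lra.
have svE : a * (s + v) = s by rewrite /a divfK.
have fsv0 : 0 <= f (s + v) by rewrite f_ge0// ltW.
have fs : f (s + v) `^ a * f 0 `^ (1 - a) <= f s.
  have := f_log_concave (ltW sv) (lexx 0) a01.
  by rewrite mulr0 addr0 svE.
have fv : f (s + v) `^ (1 - a) * f 0 `^ a <= f v.
  have := f_log_concave (ltW sv) (lexx 0) b01.
  rewrite mulr0 addr0 (_ : 1 - (1 - a) = a) 1?(_ : (1 - a) * (s + v) = v)//;
    lra.
have pow0 x y z t : 0 <= x `^ y * z `^ t :> R by rewrite mulr_ge0 ?powR_ge0.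
apply: le_trans (ler_pM (pow0 _ _ _ _) (pow0 _ _ _ _) fs fv).
rewrite mulrACA (mulrC (f 0 `^ _)) -!powRD; last 2 first.
- by rewrite subrKC oner_eq0.
- by rewrite subrKC oner_eq0.
by rewrite subrKC !powRr1 ?f_ge0 ?addr_ge0 1?mulrC.
Qed.

Hypothesis f0_ge1 : 1 <= f 0.

(** Integrate [f (s + x) <= f s * f x] over [x >= 0], where [f] has mass 1.
    This says that the hazard rate [f / F] is at least 1. *)
Lemma survival_le_density s : 0 <= s -> survival s <= f s.
Proof.
move=> s0; rewrite -lee_fin -survivalE//.
have le1 x : 0 <= x -> f (s + x) <= f s * f x.
  move=> x0; apply: le_trans (log_concave_submul s0 x0).
  by rewrite ler_peMl// f_ge0// addr_ge0.
have := @ge0_integral_ray_affine R (EFin \o f) 0 1 s ltr01.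
rewrite mulr0 add0r /tail => -> //; first last.
- by move=> r sr; rewrite lee_fin f_ge0// (le_trans s0).
- by apply: f_meas => // x; rewrite /= !in_itv/= !andbT; lra.
rewrite mul1e.
apply: (@le_trans _ _
    (\int[leb]_(x in `[0%R, +oo[) ((f s)%:E * (f x)%:E))%E); last first.
  rewrite ge0_integralZl//.
  - by rewrite -/(tail f 0) tail0 mule1.
  - exact: f_meas.
  - by move=> x; rewrite /= in_itv/= andbT => x0; rewrite lee_fin f_ge0.
  - by rewrite lee_fin f_ge0.
apply: ge0_le_integral => //=.
- by move=> x; rewrite in_itv/= andbT => x0; rewrite lee_fin f_ge0//; lra.
- have fm : measurable_fun `[0 : R, +oo[ (EFin \o f) by exact: f_meas.
  have am : measurable_fun `[0 : R, +oo[ (affine 1 s).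
    exact: measurable_funTS (measurable_affine _ _).
  apply: (measurable_comp _ _ fm am) => //.
  by move=> _ [x + <-]; rewrite /= !in_itv/= !andbT /affine; lra.
- apply: measurable_funeM; exact: f_meas.
- move=> x; rewrite in_itv/= andbT => x0.
  by rewrite mul1r addrC -EFinM lee_fin le1.
Qed.

(** On a step of length [d] the tail loses at least [d] times the density at the
    right end, hence at least [d] times its own value there. *)
Lemma survival_discrete_decay s d n : 0 <= s -> 0 <= d ->
  survival (s + n%:R * d) * (1 + d) ^+ n <= survival s.
Proof.
move=> s0 d0; elim: n => [|n ih]; first by rewrite mul0r addr0 expr0 mulr1.
apply: le_trans ih.
set x := s + n%:R * d.
have x0 : 0 <= x by rewrite addr_ge0// mulr_ge0.
have -> : s + n.+1%:R * d = x + d by rewrite /x -natr1; ring.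
have xd : x <= x + d by lra.
have := survival_drop x0 xd.
have := @survival_le_density (x + d); rewrite addr_ge0// => /(_ isT) Fle.
rewrite exprS mulrA => /andP[drop _].
rewrite ler_wpM2r ?exprn_ge0//; first lra.
have : d * survival (x + d) <= d * f (x + d) by rewrite ler_wpM2l.
lra.
Qed.

(** The integrated form of [F <= - F'].  Cutting [s, t] into [n] equal steps and
    using [d / (1 + d) <= ln (1 + d)], the discrete decay gives a lower bound
    of [ln (F s / F t)] that tends to [t - s]. *)
Lemma survival_decay s t : 0 <= s -> s <= t -> 0 < survival t ->
  t - s <= ln (survival s / survival t).
Proof.
move=> s0 st Ft0; set L := ln _.
have Fst : survival t <= survival s.
  by rewrite -lee_fin -!survivalE ?tail_nonincreasing//; lra.
have Fs0 := lt_le_trans Ft0 Fst.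
have L0 : 0 <= L by rewrite ln_ge0// ler_pdivlMr// mul1r.
pose x := t - s.
have x0 : 0 <= x by rewrite /x; lra.
(* The bound [L >= n x / (n + x)] with its denominator cleared; if [L < x], the
   left-hand side is unbounded in [n] and the right-hand side is not. *)
have key n : n.+1%:R * (x - L) <= L * x.
  have n0 : (0 : R) < n.+1%:R by [].
  pose d := x / n.+1%:R.
  have d0 : 0 <= d by rewrite divr_ge0.
  have d1 : 0 < 1 + d by lra.
  have nl : ln (1 + d) *+ n.+1 <= L.
    rewrite -lnXn// ler_ln ?posrE ?exprn_gt0 ?divr_gt0//.
    rewrite ler_pdivlMr// mulrC.
    have := survival_discrete_decay n.+1 s0 d0.
    by rewrite (_ : s + n.+1%:R * d = t)// /d mulrC divfK// /x; lra.
  have : d / (1 + d) <= ln (1 + d).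
    rewrite -[1 + d in leRHS]invrK lnV ?posrE ?invr_gt0// lerNr.
    have := @le_ln1Dx R ((1 + d)^-1 - 1).
    rewrite subrKC => le1; apply: (le_trans (le1 _)); last first.
      by rewrite -subr_ge0 (_ : _ - _ = 0)//; field; lra.
    by rewrite ltrBrDr addNr invr_gt0.
  move=> dl.
  have : n.+1%:R * (d / (1 + d)) <= L.
    by apply: le_trans nl; rewrite -[leRHS]mulr_natl ler_wpM2l.
  have -> : n.+1%:R * (d / (1 + d)) = n.+1%:R * x / (n.+1%:R + x).
    by rewrite /d; field; rewrite ?lt0r_neq0//=; lra.
  rewrite ler_pdivrMr; lra.
rewrite -/x leNgt; apply/negP => Lx.
have xL : 0 < x - L by lra.
have := archi_boundP (divr_ge0 (mulr_ge0 L0 x0) (ltW xL)).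
rewrite ltr_pdivrMr//.
set N := Num.bound _ => HN; have := key N.
rewrite -natr1; lra.
Qed.

End log_concave_density.

(** * The chaining functional *)

(** The tangent to the logarithm at [e] passes through the origin. *)
Lemma ln_le_divr_expR1 {R : realType} (w : R) : 0 < w -> ln w <= w / expR 1.
Proof.
move=> w0; have := @expR_ge1Dx R (ln w - 1).
by rewrite expRD expRN lnK// subrKC.
Qed.

Section normalized_functional.
Context {R : realType} (f h : R -> R).
Implicit Types p q : R.
Hypothesis f_density : chaining_density f.
Hypothesis h_induced : induced_by f h.

Lemma induced_ge0 p : 0 < p <= 1 -> 0 <= h p.
Proof. by move=> /h_induced[]. Qed.

Lemma survival_induced p : 0 < p <= 1 -> survival f (h p) = p.
Proof. by move=> /h_induced[_]; rewrite /survival => ->. Qed.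

(** The density has mass 1, and only the tail at 0 contains all of it. *)
Lemma induced1 : h 1 = 0.
Proof.
have p1 : 0 < (1 : R) <= 1 by rewrite ltr01 lexx.
apply: (survival_eq1 f_density); first exact: induced_ge0.
exact: survival_induced.
Qed.

Lemma induced_nonincreasing p q : 0 < p -> p <= q -> q <= 1 -> h q <= h p.
Proof.
move=> p0 pq q1.
have p01 : 0 < p <= 1 by rewrite p0 (le_trans pq).
have q01 : 0 < q <= 1 by rewrite q1 (lt_le_trans p0).
rewrite leNgt; apply/negP => hpq.
have := tail_nonincreasing f_density (induced_ge0 p01) (ltW hpq).
rewrite !(survivalE f_density) ?induced_ge0// !survival_induced// lee_fin => qp.
have pE : p = q by apply/eqP; rewrite eq_le pq qp.
by move: hpq; rewrite pE ltxx.
Qed.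

(** The mass [1 - t] of [0, h t] is at most [h t * f 0], so the slopes of [h]
    near 1 are at least [1 / f 0] in absolute value; pass to the limit. *)
Lemma density0_ge1 h'1 : is_left_derivative h 1 h'1 -> `|h'1| = 1 -> 1 <= f 0.
Proof.
move=> h_left h'1_norm.
have q_cvg : `|(h t - h 1) / (t - 1)| * f 0 @[t --> 1^'-] --> `|h'1| * f 0.
  by apply: cvgMl; exact: cvg_norm.
rewrite -[f 0]mul1r -h'1_norm -(cvg_lim (@Rhausdorff R) q_cvg).
apply: limr_ge; first by apply/cvg_ex; eexists; exact: q_cvg.
near=> t.
have t0 : 0 < t by near: t; exact: nbhs_left_gt.
have t1 : t < 1 by near: t; exact: nbhs_left_lt.
have t01 : 0 < t <= 1 by rewrite t0 ltW.
have /andP[_] := survival_drop f_density (lexx 0) (induced_ge0 t01).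
rewrite survival_induced// /survival tail0//= subr0 => drop.
rewrite h'1_norm induced1 subr0 normf_div ger0_norm ?induced_ge0//.
rewrite ler0_norm; last lra.
by rewrite mulrAC ler_pdivlMr; lra.
Unshelve. all: by end_near. Qed.

Hypothesis f_log_concave : log_concave f.
Hypothesis f0_ge1 : 1 <= f 0.

Lemma induced_drop u b : 0 < b -> b <= u -> u <= 1 ->
  h b - h u <= u / b / expR 1.
Proof.
move=> b0 bu u1; have u0 := lt_le_trans b0 bu.
have b01 : 0 < b <= 1 by rewrite b0 (le_trans bu).
have u01 : 0 < u <= 1 by rewrite u0.
have hub := induced_nonincreasing b0 bu u1.
have := @survival_decay R f f_density f_log_concave f0_ge1 (h u) (h b).
rewrite !survival_induced// => /(_ (induced_ge0 u01) hub b0) /le_trans; apply.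
by apply: ln_le_divr_expR1; rewrite divr_gt0.
Qed.

End normalized_functional.

Section extended_functional.
Context {R : realType} (h : R -> R).
Implicit Types p q b u : R.
Hypothesis h1 : h 1 = 0.
Hypothesis h_noninc : forall p q, 0 < p -> p <= q -> q <= 1 -> h q <= h p.

(** By monotonicity the limit at 0 exists and is the supremum of [h]. *)
Lemma le_extend0_0 p : 0 < p <= 1 -> ((h p)%:E <= extend0 h 0)%E.
Proof.
move=> p01; rewrite /extend0 eqxx.
have noninc : {in `]0, 1] &, nonincreasing_fun (EFin \o h)}.
  move=> x y; rewrite !in_itv/= => /andP[x0 x1] /andP[y0 y1] xy.
  by rewrite lee_fin h_noninc.
have b01 : (BRight 0 < BRight (1 : R))%O by rewrite bnd_simp.
rewrite (cvg_lim _ (nonincreasing_at_right_cvge _ b01 noninc))//.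
by apply: ereal_sup_ubound; exists p => //=; rewrite in_itv.
Qed.

Lemma extend0_posE p : 0 < p -> extend0 h p = (h p)%:E.
Proof. by move=> p0; rewrite /extend0 gt_eqF. Qed.

Lemma extend0_nonincreasing p q : 0 <= p -> p <= q -> q <= 1 ->
  (extend0 h q <= extend0 h p)%E.
Proof.
rewrite le_eqVlt => /predU1P[<-|p0] pq q1; last first.
  by rewrite !extend0_posE ?lee_fin ?h_noninc// (lt_le_trans p0).
move: pq; rewrite le_eqVlt => /predU1P[<-//|q0].
by rewrite (extend0_posE q0) le_extend0_0// q0.
Qed.

Lemma extend0_1 : extend0 h 1 = 0%E.
Proof. by rewrite extend0_posE// h1. Qed.

Lemma extend0_ge0 p : 0 <= p -> p <= 1 -> (0 <= extend0 h p)%E.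
Proof. by move=> p0 p1; rewrite -extend0_1 extend0_nonincreasing. Qed.

Hypothesis h_drop : forall u b, 0 < b -> b <= u -> u <= 1 ->
  h b - h u <= u / b / expR 1.

(** For [u < b] monotonicity of [h] suffices, so the error term costs nothing;
    this case includes [u = 0], where the right-hand side may be infinite. *)
Lemma extend0_drop u b : 0 < b -> b <= 1 -> 0 <= u -> u <= 1 ->
  (extend0 h b <= extend0 h u + (u / b / expR 1)%:E)%E.
Proof.
move=> b0 b1 u0 u1.
have [bu|ub] := leP b u; last first.
  rewrite (@le_trans _ _ (extend0 h u))//.
    by rewrite extend0_nonincreasing// ltW.
  by rewrite leeDl// lee_fin !divr_ge0// ?expR_ge0 ?ltW.
have u_gt0 := lt_le_trans b0 bu.
by rewrite !extend0_posE// -EFinD lee_fin; have := h_drop b0 bu u1; lra.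
Qed.

End extended_functional.

(** * Finite metric probability spaces *)

Section finite_metric_space.
Context {R : realType} (X : pointedMetricType R).
Hypothesis finX : finite_set [set: X].
Local Notation borel := (g_sigma_algebraType (@open X)).
Local Notation leb := (@lebesgue_measure R).
Implicit Types (mu nu : probability borel R) (x y : X) (r s : R).

Definition points : seq X := fset_set [set: X].

Lemma mem_points x : x \in points.
Proof. by rewrite /points in_fset_set// mem_set. Qed.

Lemma uniq_points : uniq points.
Proof. exact: fset_uniq. Qed.

(** A finite Hausdorff space is discrete. *)
Lemma finite_metric_measurable (A : set borel) : measurable A.
Proof.
apply: sub_sigma_algebra; rewrite /= -[A]setCK.
have /accessible_finite_set_closed cl :=
  hausdorff_accessible (@metric_hausdorff R X).
by rewrite openC; apply: cl; exact: sub_finite_set finX.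
Qed.

Lemma integral_points nu (F : X -> \bar R) : (forall x, 0 <= F x)%E ->
  (\int[nu]_x F x = \sum_(x <- points) F x * nu [set x])%E.
Proof.
move=> F0.
have mF (G : X -> \bar R) : measurable_fun [set: borel] G.
  by move=> _ B _; exact: finite_metric_measurable.
transitivity (\int[nu]_x \sum_(y <- points) F y * (\1_[set y] x)%:E)%E.
  apply: eq_integral => x _.
  rewrite (bigD1_seq x) ?mem_points ?uniq_points//= indicE mem_set// mule1.
  rewrite big1 ?adde0// => y yx; rewrite indicE memNset ?mule0//=.
  by move=> xy; move: yx; rewrite xy eqxx.
rewrite ge0_integral_sum//; last by move=> y x _; rewrite mule_ge0// lee_fin.
apply: eq_bigr => y _; rewrite ge0_integralZl//.
by rewrite integral_indic ?setIT//; exact: finite_metric_measurable.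
Qed.

Definition mass mu x : R := fine (mu [set x]).

Definition ball_mass mu x r : R := fine (mu (cball x r)).

Lemma massE mu x : mu [set x] = (mass mu x)%:E.
Proof.
by rewrite fineK// fin_num_measure//; exact: finite_metric_measurable.
Qed.

Lemma mass_ge0 mu x : 0 <= mass mu x.
Proof. by rewrite fine_ge0. Qed.

Lemma measure_points mu (A : set X) :
  fine (mu A) = \sum_(y <- points) mass mu y * \1_A y.
Proof.
have mA : measurable (A : set borel) by exact: finite_metric_measurable.
rewrite -[A in LHS](setIT A) -[mu _](integral_indic mu measurableT mA).
rewrite integral_points; last by move=> y; rewrite lee_fin.
under eq_bigr do rewrite massE -EFinM mulrC.
by rewrite sumEFin.
Qed.

Lemma sum_mass mu : \sum_(y <- points) mass mu y = 1.
Proof.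
have := measure_points mu setT; rewrite probability_setT /= => ->.
by apply: eq_bigr => y _; rewrite indicE mem_set// mulr1.
Qed.

Lemma ball_massE mu x r :
  ball_mass mu x r = \sum_(y <- points) mass mu y * (mdist x y <= r)%R%:R.
Proof.
rewrite /ball_mass measure_points; apply: eq_bigr => y _; rewrite indicE.
congr (_ * _%:R); congr nat_of_bool; apply/idP/idP;
  by rewrite in_setE.
Qed.

Lemma fine_measure_mono mu (A B : set X) : A `<=` B ->
  fine (mu A) <= fine (mu B).
Proof.
move=> AB.
have mE (E : set X) : measurable (E : set borel).
  exact: finite_metric_measurable.
rewrite fine_le ?fin_num_measure//; try exact: mE.
by rewrite le_measure// in_setE; exact: mE.
Qed.

Lemma ball_mass_ge0 mu x r : 0 <= ball_mass mu x r.
Proof. by rewrite fine_ge0. Qed.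

Lemma ball_mass_le1 mu x r : ball_mass mu x r <= 1.
Proof.
rewrite -lee_fin fineK ?probability_le1//.
  exact: finite_metric_measurable.
by rewrite fin_num_measure//; exact: finite_metric_measurable.
Qed.

Lemma mass_le_ball_mass mu x y r : mdist y x <= r ->
  mass mu x <= ball_mass mu y r.
Proof. by move=> yxr; apply: fine_measure_mono => _ ->. Qed.

Lemma mdist_le_diam x y : mdist x y <= diam X.
Proof.
apply: ub_le_sup; last by exists (x, y).
exists (\big[Order.max/0]_(u <- points)
  \big[Order.max/0]_(v <- points) mdist u v).
move=> _ [[u v] _ <-] /=.
apply: bigmax_sup_seq (mem_points u) _ _ => //.
exact: bigmax_sup_seq (mem_points v) _ _.
Qed.

Lemma diam_ge0 : 0 <= diam X.
Proof. by rewrite -(mdistxx (point : X)) mdist_le_diam. Qed.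

Lemma ball_mass_diam mu x r : diam X <= r -> ball_mass mu x r = 1.
Proof.
move=> Dr; rewrite ball_massE -[RHS](sum_mass mu); apply: eq_bigr => y _.
have -> : mdist x y <= r by rewrite (le_trans (mdist_le_diam x y)).
by rewrite mulr1.
Qed.

(** Double counting over the pairs [(x, y)] at distance at most [r]: expanding
    the mass of [B (x, r)] and exchanging the sums, the [mu]-mass of each [y] is
    multiplied by the [nu]-integral over [x] in [B (y, r)] of
    [1 / nu (B (x, 2 r))].  For such [x] the ball [B (x, 2 r)] contains
    [B (y, r)], so this integral is at most 1. *)
Lemma mean_ball_ratio_le1 mu nu r :
  \sum_(x <- points)
    mass nu x * (ball_mass mu x r / ball_mass nu x (2 * r)) <= 1.
Proof.
pose c x y : R := (mdist x y <= r)%R%:R.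
apply: (@le_trans _ _ (\sum_(x <- points) \sum_(y <- points)
    mass mu y * (mass nu x * c y x / ball_mass nu y r))).
  apply: ler_sum => x _; rewrite ball_massE mulr_suml mulr_sumr.
  apply: ler_sum => y _; rewrite -[X in _ * X <= _]mulrA mulrCA.
  apply: ler_wpM2l; first exact: mass_ge0.
  rewrite -/(c x y).
  have [->|nu0] := eqVneq (mass nu x) 0; first by rewrite !mul0r.
  have nux : 0 < mass nu x by rewrite lt_neqAle eq_sym nu0 mass_ge0.
  rewrite /c (metric_sym y); case: (leP (mdist x y) r) => xy; last first.
    by rewrite !(mulr0, mul0r).
  rewrite mul1r mulr1; apply: ler_wpM2l; first exact: ltW.
  have y0 : 0 < ball_mass nu y r.
    by rewrite (lt_le_trans nux)// mass_le_ball_mass// metric_sym.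
  have yx : ball_mass nu y r <= ball_mass nu x (2 * r).
    apply: fine_measure_mono => z; rewrite /cball/= => yz.
    have := metric_triangle x y z; lra.
  by rewrite lef_pV2// posrE// (lt_le_trans y0).
rewrite exchange_big/= -[leRHS](sum_mass mu); apply: ler_sum => y _.
rewrite -mulr_sumr -mulr_suml -ball_massE.
rewrite ler_piMr ?mass_ge0//.
have [->|B0] := eqVneq (ball_mass nu y r) 0; first by rewrite mul0r.
by rewrite divff.
Qed.

End finite_metric_space.

(** * Comparison of the energies *)

Lemma nonincreasing_emeasurable {R : realType} (D : set R) (g : R -> \bar R) :
  measurable D -> {homo g : x y / (x <= y)%R >-> (y <= x)%E} ->
  measurable_fun D g.
Proof.
move=> mD g_noninc.
apply: (measurability _ (ErealGenCInfty.measurableE R)) => // _ [_ [r ->] <-].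
apply: measurableI => //; apply: is_interval_measurable => s t/=.
rewrite !in_itv/= !andbT => _ gt u /andP[_ ut].
by rewrite in_itv/= andbT (le_trans gt)// g_noninc.
Qed.

Section energy.
Context {R : realType} (X : pointedMetricType R).
Hypothesis finX : finite_set [set: X].
Variable h : R -> R.
Hypothesis h1 : h 1 = 0.
Hypothesis h_noninc : forall p q, 0 < p -> p <= q -> q <= 1 -> h q <= h p.
Hypothesis h_drop : forall u b, 0 < b -> b <= u -> u <= 1 ->
  h b - h u <= u / b / expR 1.
Local Notation borel := (g_sigma_algebraType (@open X)).
Local Notation leb := (@lebesgue_measure R).
Implicit Types (mu nu : probability borel R) (x y : X) (r s : R).

Let potential mu x r : \bar R := extend0 h (ball_mass mu x r).

Let mean_potential mu nu r : \bar R :=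
  (\sum_(x <- points X) potential mu x r * nu [set x])%E.

Let potential_ge0 mu x r : (0 <= potential mu x r)%E.
Proof.
by apply: extend0_ge0 => //; [exact: ball_mass_ge0|exact: ball_mass_le1].
Qed.

Let potential_noninc mu x r s : r <= s ->
  (potential mu x s <= potential mu x r)%E.
Proof.
move=> rs; apply: extend0_nonincreasing => //.
- exact: ball_mass_ge0.
- by apply: fine_measure_mono => // y; rewrite /cball/= => /le_trans; apply.
- exact: ball_mass_le1.
Qed.

Let mean_potential_ge0 mu nu r : (0 <= mean_potential mu nu r)%E.
Proof. by apply: sume_ge0 => x _; rewrite mule_ge0. Qed.

Let mean_potential_noninc mu nu r s : r <= s ->
  (mean_potential mu nu s <= mean_potential mu nu r)%E.
Proof.
move=> rs; apply: lee_sum => x _.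
by apply: lee_wpmul2r => //; exact: potential_noninc.
Qed.

(** The integral over [X] is a finite sum, which goes through the integral over
    radii by linearity. *)
Lemma chaining_energyE mu nu : chaining_energy h mu nu =
  (\int[leb]_(r in `[0%R, +oo[) mean_potential mu nu r)%E.
Proof.
rewrite /chaining_energy integral_points//; last first.
  by move=> x; apply: integral_ge0 => r _; exact: potential_ge0.
rewrite ge0_integral_sum//; last 2 first.
- move=> x; apply: emeasurable_funM; last exact: measurable_cst.
  by apply: nonincreasing_emeasurable => // r s; exact: potential_noninc.
- by move=> x r _; rewrite mule_ge0.
apply: eq_bigr => x _; rewrite massE//.
rewrite ge0_integralZr ?lee_fin ?mass_ge0//.
by apply: nonincreasing_emeasurable => // r s; exact: potential_noninc.
Qed.

(** The core of the comparison, at a fixed radius: [extend0_drop] at each point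
    of positive mass, then [mean_ball_ratio_le1].  The bound is cut off beyond
    half the diameter because the left-hand side vanishes there. *)
Lemma mean_potential_doubling mu nu r : 0 <= r ->
  (mean_potential nu nu (2 * r)%R <= mean_potential mu nu r +
    (\1_`[0%R, (diam X / 2)%R] r * (expR 1)^-1)%:E)%E.
Proof.
move=> r0; rewrite indicE; have [rD|Dr] := leP r (diam X / 2); last first.
  have -> : mean_potential nu nu (2 * r)%R = 0%E.
    rewrite /mean_potential big1// => x _.
    rewrite /potential ball_mass_diam//; last lra.
    by rewrite extend0_1// mul0e.
  by rewrite adde_ge0// lee_fin mulr_ge0// invr_ge0 expR_ge0.
rewrite mem_set/= ?in_itv/= ?r0// mul1r.
apply: (@le_trans _ _ (mean_potential mu nu r + (\sum_(x <- points X)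
   mass nu x * (ball_mass mu x r / ball_mass nu x (2 * r)) / expR 1)%:E)%E).
  rewrite -sumEFin -big_split/=; apply: lee_sum => x _.
  (* A point without mass may have an infinite potential: its ball of radius
     [2 r] may be null, so that only the coefficient 0 saves the bound. *)
  rewrite massE//; have [->|nu0] := eqVneq (mass nu x) 0.
    by rewrite !mul0r !mule0 adde0.
  have nux : 0 < mass nu x by rewrite lt_neqAle eq_sym nu0 mass_ge0.
  rewrite -mulrA EFinM [X in (_ + X)%E]muleC -ge0_muleDl//; last first.
    by rewrite lee_fin !divr_ge0 ?expR_ge0 ?ball_mass_ge0.
  apply: lee_wpmul2r; first by rewrite lee_fin ltW.
  apply: extend0_drop => //; try exact: ball_mass_ge0; try exact: ball_mass_le1.
  rewrite (lt_le_trans nux)// mass_le_ball_mass// mdistxx; lra.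
rewrite leeD2l// lee_fin -mulr_suml ler_piMl ?invr_ge0 ?expR_ge0//.
exact: mean_ball_ratio_le1.
Qed.

Lemma entropic_energy_le mu nu :
  (chaining_energy h nu nu <=
   2%:E * chaining_energy h mu nu + (diam X / expR 1)%:E)%E.
Proof.
pose bump r : \bar R := (\1_`[0%R, (diam X / 2)%R] r * (expR 1)^-1)%:E.
have bump_ge0 r : (0 <= bump r)%E.
  by rewrite lee_fin mulr_ge0// invr_ge0 expR_ge0.
have m_bump : measurable_fun `[0 : R, +oo[ bump.
  by apply/measurable_EFinP; apply: measurable_funM.
have int_bump :
    (\int[leb]_(r in `[0%R, +oo[) bump r = (diam X / expR 1 / 2)%:E)%E.
  under eq_integral do rewrite /bump EFinM.
  rewrite ge0_integralZr//; last exact/measurable_EFinP.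
  rewrite integral_indic//= setIidl; last first.
    by move=> r /=; rewrite !in_itv/= andbT => /andP[].
  rewrite lebesgue_measure_itv/= lte_fin; case: ltP => [_|D0].
    by rewrite -EFinD -EFinM; congr EFin; ring.
  have -> : diam X = 0 by have := @diam_ge0 R X finX; lra.
  by rewrite mul0e !mul0r.
have m_mean : measurable_fun `[0 : R, +oo[ (mean_potential mu nu).
  by apply: nonincreasing_emeasurable => // r s; exact: mean_potential_noninc.
have := @ge0_integral_ray_affine R (mean_potential nu nu) 0 2 0.
rewrite !chaining_energyE mulr0 add0r => -> //; last first.
  by apply: nonincreasing_emeasurable => // r s; exact: mean_potential_noninc.
apply: (@le_trans _ _ (2%:E * \int[leb]_(r in `[0%R, +oo[)
  (mean_potential mu nu r + bump r))%E).
  apply: lee_wpmul2l => //; apply: ge0_le_integral => //.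
  - apply: nonincreasing_emeasurable => // r s rs.
    by apply: mean_potential_noninc; lra.
  - exact: emeasurable_funD.
  - move=> r; rewrite /= in_itv/= andbT addr0.
    exact: mean_potential_doubling.
rewrite ge0_integralD//.
rewrite int_bump ge0_muleDr ?integral_ge0//; last first.
  by rewrite lee_fin !divr_ge0 ?expR_ge0 ?diam_ge0.
by rewrite -EFinM [(2 * _)%R]mulrC divfK.
Qed.

End energy.

Theorem corollary1p5 (R : realType) (X : pointedMetricType R)
    (finX : finite_set [set: X])
    (h : R -> R) (h_chaining : log_concave_chaining_functional h)
    (h'1 : R) (h_left : is_left_derivative h 1 h'1) (h'1_norm : `|h'1| = 1) :
  (dual_program X h <= entropic_dual X h)%E /\
  (entropic_dual X h <= 2%:E * dual_program X h + (diam X / expR 1)%:E)%E.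
Proof.
case: h_chaining => f [f_density f_lc h_ind].
have f0 := density0_ge1 f_density h_ind h_left h'1_norm.
split.
  apply: ge_ereal_sup => _ [nu _ <-].
  apply: (@le_trans _ _ (chaining_energy h nu nu)).
    by apply: ereal_inf_lbound; exists nu.
  by apply: ereal_sup_ubound; exists nu.
apply: ge_ereal_sup => _ [nu _ <-].
(* Isolating the dual program on the right turns the bound on each energy of
   [(mu, nu)] into a lower bound of their infimum over [mu]. *)
rewrite -leeBlDr// -lee_pdivrMl//.
apply: (@le_trans _ _ (ereal_inf [set chaining_energy h mu nu
    | mu in [set: probability (g_sigma_algebraType (@open X)) R]])); last first.
  by apply: ereal_sup_ubound; exists nu.
apply: le_ereal_inf_tmp => _ [mu _ <-].
rewrite lee_pdivrMl// leeBlDr//.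
apply: entropic_energy_le => //.
- exact: induced1 f_density h_ind.
- by move=> p q; exact: (induced_nonincreasing f_density h_ind).
- by move=> u b; exact: (induced_drop f_density h_ind f_lc f0).
Qed.
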